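(* Let $\sigma=\sum_{j=1}^m q_j\delta_{y_j}$ with $y_1<\dots<y_m$, $q_j>0$, $\sum_{j=1}^m q_j=1$, and $\mu=\sum_{i=1}^n p_i\delta_{x_i}$ with $x_1<\dots<x_n$, $p_i>0$, $\sum_{i=1}^n p_i=1$, be probability measures on $\mathbb{R}$. Let $S:\mathbb{R}\to\mathbb{R}$ be strictly increasing and let $\nu=S_\#\mu$. Then the discrete cumulative distribution transforms of $\nu$ and $\mu$ relative to $\sigma$ satisfy $$T_\nu(y_j)=S(T_\mu(y_j)),\qquad j=1,\dots,m.$$ Equivalently, $T_\nu=S\circ T_\mu$ on the support of $\sigma$.
   Context: For a Borel probability measure $\mu$ on $\mathbb{R}$, $F_\mu(x)=\mu((-\infty,x])$ is its cumulative distribution function, and its generalized inverse is $F_\mu^{-1}(s)=\inf\{x\in\mathbb{R}: F_\mu(x)\ge s\}$ for $s\in(0,1]$. The discrete cumulative distribution transform (CDT) of an atomic probability measure $\mu$ relative to $\sigma$ is the map $T_\mu=F_\mu^{-1}\circ F_\sigma$, determined by its values on the support $\{y_1,\dots,y_m\}$ of $\sigma$. The pushforward is $(S_\#\mu)(A)=\mu(S^{-1}(A))$ for Borel sets $A$. $\delta_x$ is the Dirac mass at $x$. *)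

(* Defs.v *)
From mathcomp Require Import all_boot all_order all_algebra.
From mathcomp Require Import all_classical all_reals all_analysis.

Set Implicit Arguments.
Unset Strict Implicit.
Unset Printing Implicit Defensive.

Import Order.TTheory GRing.Theory Num.Theory.
Import numFieldNormedType.Exports.

Local Open Scope classical_set_scope.
Local Open Scope ring_scope.

Notation borel_probability R := (probability (measurableTypeR R) R).

(* The library's cdf takes a random variable instead of a measure.  The value of
   mu is finite here, hence fine loses nothing. *)
Definition measure_cdf (R : realType) (mu : borel_probability R) (x : R) : R :=
  fine (mu `]-oo, x]%classic).

(* Meant for 0 < s <= 1.  The infimum is taken in R (inf set0 = 0); if F is the
   cdf of a finitely supported probability measure, the set is nonempty and
   bounded below for all such s. *)
Definition generalized_inverse (R : realType) (F : R -> R) (s : R) : R :=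
  inf [set x | s <= F x].

Definition CDT (R : realType) (sigma mu : borel_probability R) : R -> R :=
  generalized_inverse (measure_cdf mu) \o measure_cdf sigma.

Definition measure_support (R : realType) (mu : borel_probability R) : set R :=
  [set t | forall U : set R, open U -> U t -> (0 < mu U)%E].

(* Measures are only determined on measurable sets: the value of a measure on
   a non-measurable set carries no meaning. *)
Definition is_atomic (R : realType) (mu : borel_probability R)
    (n : nat) (p x : 'I_n -> R) : Prop :=
  forall A : set (measurableTypeR R), measurable A ->
    mu A = (\sum_(i < n) (p i)%:E * \d_(x i) A)%E.

Definition is_pushforward (R : realType) (S : R -> R)
    (mu nu : borel_probability R) : Prop :=
  forall A : set (measurableTypeR R), measurable A ->
    nu A = pushforward mu (S : measurableTypeR R -> measurableTypeR R) A.

(* Main.v *)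
(* With k the least index such that p_0 + ... + p_k >= s, the generalized inverse
   at s of the cdf of \sum_i p_i \delta_(w_i), w increasing, is w_k.  The index k
   depends on the weights only, and the pushforward of \sum_i p_i \delta_(x_i)
   by S is \sum_i p_i \delta_(S x_i), with the same weights. *)
Require Import Defs.
From mathcomp Require Import all_boot all_order all_algebra.
From mathcomp Require Import all_classical all_reals all_analysis.
From mathcomp Require Import measurable_realfun.

Import Order.TTheory GRing.Theory Num.Theory.
Import numFieldNormedType.Exports.

Local Open Scope classical_set_scope.
Local Open Scope ring_scope.

Lemma atomic_measureE (R : realType) (mu : borel_probability R) (n : nat)
    (p x : 'I_n -> R) (A : set (measurableTypeR R)) :
  is_atomic mu p x -> measurable A ->
  mu A = (\sum_(i < n | x i \in A) p i)%:E.
Proof.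
move=> muE mA; rewrite muE // [in RHS]big_mkcond /= -sumEFin.
by apply: eq_bigr => i _; rewrite diracE -EFinM mulr_natr mulrb.
Qed.

Lemma atomic_cdfE (R : realType) (mu : borel_probability R) (n : nat)
    (p x : 'I_n -> R) (z : R) :
  is_atomic mu p x -> measure_cdf mu z = \sum_(i < n | x i <= z) p i.
Proof.
move=> muE; rewrite /measure_cdf (atomic_measureE _ _ _ _ _ _ muE) //=.
by apply: eq_bigl => i; rewrite mem_setE in_itv.
Qed.

(** The Dirac mass at [x i] of the preimage of [A] under [S] is the Dirac mass at [S (x i)] of [A].
    Monotonicity makes [S] Borel, so that the formula for [mu] applies to this preimage. *)
Lemma atomic_pushforward (R : realType) (S : R -> R)
    (mu nu : borel_probability R) (n : nat) (p x : 'I_n -> R) :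
  {homo S : a b / a <= b} -> is_pushforward S mu nu ->
  is_atomic mu p x -> is_atomic nu p (S \o x).
Proof.
move=> S_nd nuE muE A mA; rewrite nuE // /pushforward muE.
  by apply: eq_bigr => i _; rewrite !diracE.
rewrite -[X in measurable X]setTI.
exact: (nondecreasing_measurable measurableT S_nd).
Qed.

(** The range of [x] is finite, hence closed; its complement is an open set of measure zero, which
    no point of the support can have as a neighbourhood. *)
Lemma atomic_support (R : realType) (mu : borel_probability R) (n : nat)
    (p x : 'I_n -> R) (t : R) :
  is_atomic mu p x -> measure_support mu t -> exists i, x i = t.
Proof.
move=> muE supp_t; apply: contrapT => xNt.
have oU : open (~` range x).
  apply: closed_openC; move: (range x) (finite_image x (@finite_finset _ setT)).
  exact/accessible_finite_set_closed/hausdorff_accessible/Rhausdorff.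
have Ut : (~` range x) t by case=> i _ xit; apply: xNt; exists i.
have := supp_t _ oU Ut.
rewrite (atomic_measureE _ _ _ _ _ _ muE); last exact: open_measurable.
rewrite big1 ?ltxx // => i; rewrite inE => xiU.
by case: xiU; exists i.
Qed.

Lemma ler_sum_pred (R : numDomainType) (I : finType) (f : I -> R)
    (A B : pred I) :
  (forall i, 0 <= f i) -> (forall i, A i -> B i) ->
  \sum_(i | A i) f i <= \sum_(i | B i) f i.
Proof.
move=> f_ge0 AB; rewrite big_mkcond [leRHS]big_mkcond /=.
by apply: ler_sum => i _; case: (boolP (A i)) => [/AB -> //|_]; case: ifP.
Qed.

(** The index [k] is quantified before [w], so that one [k] serves both [x] and [S \o x]. *)
Lemma generalized_inverse_step (R : realType) (n : nat)
    (p : 'I_n -> R) (s : R) :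
  (forall i, 0 <= p i) -> 0 < s <= \sum_(i < n) p i ->
  exists k : 'I_n, forall w : 'I_n -> R, {homo w : i j / (i < j)%N >-> i < j} ->
    generalized_inverse (fun z => \sum_(i < n | w i <= z) p i) s = w k.
Proof.
case: n p => [|n] p p_ge0 /andP[s_gt0 s_le].
  by rewrite big_ord0 leNgt s_gt0 in s_le.
pose P (k : 'I_n.+1) := s <= \sum_(i < n.+1 | (i <= k)%N) p i.
have P_max : P ord_max.
  by rewrite /P (eq_bigl xpredT) // => i; rewrite -ltnS ltn_ord.
case: (arg_minnP (P := P) (fun i => nat_of_ord i) P_max) => k Pk k_min.
exists k => w w_incr; rewrite /generalized_inverse.
(* The superlevel set is a closed half-line, so the infimum is its left endpoint. *)
suff -> : [set z | s <= \sum_(i < n.+1 | w i <= z) p i] = `[w k, +oo[%classic.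
  exact: inf_itv.
apply/seteqP; split => z /=; rewrite in_itv /= andbT.
  apply: contraTT; rewrite -!ltNge => z_lt.
  have lt_k i : w i <= z -> (i < k)%N.
    move=> wiz; have := le_lt_trans wiz z_lt; rewrite ltnNge; apply: contraTN.
    by rewrite leq_eqVlt => /orP[/eqP/val_inj-> | /w_incr/ltW]; rewrite -leNgt.
  (* For [z < w k] only indices below [k] contribute. If [k = 0] the sum is empty, and [0 < s]
     concludes; otherwise it is at most the partial sum up to [k.-1], which is below [s] by
     minimality of [k]. *)
  have [k0|k_gt0] := posnP k.
    by rewrite big1 // => i /lt_k; rewrite k0.
  have k1n : (k.-1 < n.+1)%N by rewrite (leq_ltn_trans (leq_pred k)).
  have : ~~ P (Ordinal k1n).
    apply: contraL k_gt0 => /k_min /=.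
    by case: (nat_of_ord k) => // ?; rewrite ltnn.
  rewrite /P -ltNge; apply: le_lt_trans; apply: ler_sum_pred => // i /lt_k /=.
  by case: (nat_of_ord k).
move=> wkz; apply: le_trans Pk _; apply: ler_sum_pred => // i ik.
apply: le_trans wkz; move: ik.
by rewrite leq_eqVlt => /orP[/eqP/val_inj-> | /w_incr/ltW].
Qed.

Theorem proposition5p3 (R : realType) (m n : nat)
    (q y : 'I_m -> R) (p x : 'I_n -> R) (S : R -> R)
    (sigma mu nu : borel_probability R)
    (y_incr : forall j k : 'I_m, (j < k)%N -> y j < y k)
    (q_gt0 : forall j : 'I_m, 0 < q j)
    (q_sum1 : \sum_(j < m) q j = 1)
    (sigmaE : is_atomic sigma q y)
    (x_incr : forall i k : 'I_n, (i < k)%N -> x i < x k)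
    (p_gt0 : forall i : 'I_n, 0 < p i)
    (p_sum1 : \sum_(i < n) p i = 1)
    (muE : is_atomic mu p x)
    (S_incr : forall a b : R, a < b -> S a < S b)
    (nuE : is_pushforward S mu nu) :
  (forall j : 'I_m, CDT sigma nu (y j) = S (CDT sigma mu (y j))) /\
  (forall t : R, measure_support sigma t ->
     CDT sigma nu t = (S \o CDT sigma mu) t).
Proof.
have S_nd : {homo S : a b / a <= b}.
  by move=> a b; rewrite le_eqVlt => /orP[/eqP-> | /S_incr/ltW].
have nu_atomic := atomic_pushforward _ _ _ _ _ _ _ S_nd nuE muE.
suff CDT_atom j : CDT sigma nu (y j) = S (CDT sigma mu (y j)).
  split=> // t /(atomic_support _ _ _ _ _ _ sigmaE)[j <-] /=; exact: CDT_atom.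
(* The atom [y j] itself contributes [q j > 0]; the upper bound holds because both families of
   weights sum to 1. *)
have s_itv : 0 < measure_cdf sigma (y j) <= \sum_(i < n) p i.
  rewrite (atomic_cdfE _ _ _ _ _ _ sigmaE) p_sum1 -q_sum1; apply/andP; split.
    rewrite (bigD1 j) //= ltr_pwDl ?sumr_ge0 // => i _; exact: ltW.
  by apply: ler_sum_pred => // i; exact: ltW.
have [k kE] := generalized_inverse_step _ _ _ _ (fun i => ltW (p_gt0 i)) s_itv.
have cdf_mu : measure_cdf mu = fun z => \sum_(i < n | x i <= z) p i.
  by apply/funext => z; exact: atomic_cdfE.
have cdf_nu : measure_cdf nu = fun z => \sum_(i < n | (S \o x) i <= z) p i.
  by apply/funext => z; exact: atomic_cdfE.
(* Strict monotonicity of [S] keeps the atoms [S (x i)] in increasing order, so [kE] applies to them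
   as well as to [x]. *)
by rewrite /CDT /= cdf_mu cdf_nu !kE // => a b /x_incr/S_incr.
Qed.
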